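(* Let $\alpha_g=-\min(0,\lambda_{\min}(Q,I_n+A^TA))$ and $\alpha_z=-\min(0,\lambda_{\min}(Z^TQZ))$. Let $\mu_{\mathrm{GEIG}}$ denote the optimal objective function value of $$\min_{x\in\mathcal X}\ x^T\big(Q+\alpha_g(I_n+A^TA)\big)x+\big(q-\alpha_g(l+u+2A^Tb)\big)^Tx+\alpha_g(l^Tu+b^Tb),$$ and let $\mu_{\mathrm{EIGZ}}$ denote the optimal objective function value of $$\min_{x\in\mathcal X}\ x^T(Q+\alpha_zI_n)x+\big(q-\alpha_z(l+u)\big)^Tx+\alpha_z\,l^Tu.$$ Then $\mu_{\mathrm{EIGZ}}\ge\mu_{\mathrm{GEIG}}$.
   Context: $Q\in\mathbb R^{n\times n}$ is symmetric, $q\in\mathbb R^n$, and $\mathcal X=\{x\in\mathbb R^n: Ax=b,\ Cx\le d,\ l\le x\le u\}$ with $A\in\mathbb R^{m\times n}$, $b\in\mathbb R^m$, $C\in\mathbb R^{p\times n}$, $d\in\mathbb R^p$, and finite bounds $-\infty<l_i<u_i<\infty$ for all $i$. $Z$ is a matrix whose columns form an orthonormal basis of the nullspace of $A$, which is implicitly nontrivial so that $\lambda_{\min}(Z^TQZ)$ is defined. $I_n$ is the identity, $\lambda_{\min}(M)$ is the smallest eigenvalue of a symmetric matrix $M$, and for symmetric $M,N$ with $N\succ0$ (positive definite), $\lambda_{\min}(M,N)$ is the smallest generalized eigenvalue of $Mv=\lambda Nv$, i.e. $\lambda_{\min}(M,N)=\min_{x\ne0}\frac{x^TMx}{x^TNx}$.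 *)

(* Defs.v *)
From mathcomp Require Import all_boot all_order all_algebra.
From mathcomp Require Import all_classical all_reals ereal.
Set Implicit Arguments.
Unset Strict Implicit.
Unset Printing Implicit Defensive.

Import Order.TTheory GRing.Theory Num.Theory.
Local Open Scope classical_set_scope.
Local Open Scope ring_scope.

Definition dotv (R : realType) (n : nat) (x y : 'cV[R]_n) : R :=
  (x^T *m y) 0 0.

Definition quadform (R : realType) (n : nat) (M : 'M[R]_n) (x : 'cV[R]_n) : R :=
  (x^T *m M *m x) 0 0.

Definition quadobj (R : realType) (n : nat) (M : 'M[R]_n) (c : 'cV[R]_n)
    (k : R) (x : 'cV[R]_n) : R :=
  quadform M x + dotv c x + k.

Definition generalized_eigenvalue (R : realType) (n : nat) (M N : 'M[R]_n)
    (a : R) : Prop :=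
  exists2 v : 'cV[R]_n, v != 0 & M *m v = a *: (N *m v).

(* For M symmetric of size n > 0 the set of eigenvalues is finite and nonempty,
   so the infimum is its minimum. [eigenvalue] refers to row eigenvectors, which
   for symmetric M are the transposes of the column ones. Since [inf] is 0 on
   the empty set, this must not be used at size 0. *)
Definition lambda_min (R : realType) (n : nat) (M : 'M[R]_n) : R :=
  inf [set a : R | eigenvalue M a].

(* Likewise a minimum, for M symmetric and N symmetric positive definite of
   size n > 0. *)
Definition lambda_min_gen (R : realType) (n : nat) (M N : 'M[R]_n) : R :=
  inf [set a : R | generalized_eigenvalue M N a].

Definition feasible (R : realType) (n m p : nat)
    (A : 'M[R]_(m, n)) (b : 'cV[R]_m) (C : 'M[R]_(p, n)) (d : 'cV[R]_p)
    (l u : 'cV[R]_n) : set 'cV[R]_n :=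
  [set x | [/\ A *m x = b,
               forall i, (C *m x) i 0 <= d i 0 &
               forall i, l i 0 <= x i 0 <= u i 0]].

(* The kernel of A^T in MathComp's row convention is the set of the transposes
   of the x with A *m x = 0, and the rows of Z^T are the columns of Z. *)
Definition orthonormal_nullbasis (R : realType) (n m k : nat)
    (A : 'M[R]_(m, n)) (Z : 'M[R]_(n, k)) : Prop :=
  Z^T *m Z = 1%:M /\ (Z^T == kermx A^T)%MS.

(* +oo if X is empty; the minimum of f if it is attained on X. *)
Definition optimal_value (R : realType) (n : nat) (X : set 'cV[R]_n)
    (f : 'cV[R]_n -> R) : \bar R :=
  ereal_inf [set (f x)%:E | x in X].

(* Main.v *)
Require Import Defs.
From mathcomp Require Import all_boot all_order all_algebra.
From mathcomp Require Import all_classical all_reals ereal.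
From mathcomp Require Import lra.
Set Implicit Arguments.
Unset Strict Implicit.
Unset Printing Implicit Defensive.

Import Order.TTheory GRing.Theory Num.Theory.
Local Open Scope ring_scope.

(** Both objectives are the original x^T Q x + q^T x plus a multiple of a
    quantity that is nonpositive on the feasible set: completing squares, the
    multiplier alpha_z comes with (x - l)^T (x - u), and alpha_g comes with
    (x - l)^T (x - u) + |A x - b|^2, where the square vanishes because A x = b.
    On the box (x - l)^T (x - u) <= 0, so the larger multiplier gives the
    pointwise smaller objective, and everything reduces to alpha_z <= alpha_g
    ([quadobj_perturb_box], [quadobj_perturb_box_eq]).

    For the multipliers, let w be an eigenvector of Z^T Q Z for the eigenvalue
    a. Then x = Z w satisfies A x = 0 and x^T x = w^T w, hence
    x^T Q x = a x^T (I + A^T A) x: the eigenvalue a is a value of the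
    generalized Rayleigh quotient, whose minimum is the smallest generalized
    eigenvalue ([lambda_min_gen_le_rayleigh]).

    The variational characterization of the smallest generalized eigenvalue is
    proved without compactness. Let t be the infimum of the Rayleigh quotient of
    (M, N). Then S = M - t N is positive semidefinite; were it invertible, it
    would dominate a positive multiple of the identity ([psd_unit_coercive]),
    hence a positive multiple of N, and t could be increased. So S is singular,
    which says that t is a generalized eigenvalue ([rayleigh_inf_eigenvalue]).
    Applied to every eigenvalue a of Z^T Q Z, this bounds their infimum from
    below; the formal case of an empty set of eigenvalues, whose infimum is 0 by
    convention, gives alpha_z = 0 <= alpha_g ([multiplier_le]). *)

(** * Dot product and quadratic forms *)

Section SymmetricForms.
Variables (R : realType).
Implicit Types n m : nat.

Lemma dotvE n (x y : 'cV[R]_n) : dotv x y = \sum_i x i 0 * y i 0.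
Proof. by rewrite /dotv mxE; apply: eq_bigr => i _; rewrite mxE. Qed.

Lemma dotvC n (x y : 'cV[R]_n) : dotv x y = dotv y x.
Proof. by rewrite !dotvE; apply: eq_bigr => i _; rewrite mulrC. Qed.

Lemma dotvDr n (x y z : 'cV[R]_n) : dotv x (y + z) = dotv x y + dotv x z.
Proof. by rewrite /dotv mulmxDr mxE. Qed.

Lemma dotvZr n c (x y : 'cV[R]_n) : dotv x (c *: y) = c * dotv x y.
Proof. by rewrite /dotv -scalemxAr mxE. Qed.

Lemma dotvBr n (x y z : 'cV[R]_n) : dotv x (y - z) = dotv x y - dotv x z.
Proof. by rewrite /dotv mulmxBr !mxE. Qed.

Lemma dotvDl n (x y z : 'cV[R]_n) : dotv (x + y) z = dotv x z + dotv y z.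
Proof. by rewrite dotvC dotvDr !(dotvC z). Qed.

Lemma dotvZl n c (x y : 'cV[R]_n) : dotv (c *: x) y = c * dotv x y.
Proof. by rewrite dotvC dotvZr dotvC. Qed.

Lemma dotvBl n (x y z : 'cV[R]_n) : dotv (x - y) z = dotv x z - dotv y z.
Proof. by rewrite dotvC dotvBr !(dotvC z). Qed.

Lemma dotv_adjoint n m (B : 'M[R]_(m, n)) (x : 'cV[R]_m) (y : 'cV[R]_n) :
  dotv (B^T *m x) y = dotv x (B *m y).
Proof. by rewrite /dotv trmx_mul trmxK mulmxA. Qed.

Lemma dotvv_ge0 n (x : 'cV[R]_n) : 0 <= dotv x x.
Proof. by rewrite dotvE; apply: sumr_ge0 => i _; rewrite -expr2 sqr_ge0. Qed.

Lemma sqr_coord_le n (x : 'cV[R]_n) i : x i 0 ^+ 2 <= dotv x x.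
Proof.
rewrite dotvE (bigD1 i) //= -expr2 lerDl.
by apply: sumr_ge0 => j _; rewrite -expr2 sqr_ge0.
Qed.

Lemma dotvv_gt0 n (x : 'cV[R]_n) : x != 0 -> 0 < dotv x x.
Proof.
move=> x0; rewrite lt0r dotvv_ge0 andbT; apply: contra x0 => /eqP xx0.
apply/eqP/matrixP => i j; rewrite ord1 [RHS]mxE; apply/eqP.
by rewrite -sqrf_eq0 eq_le sqr_ge0 andbT -xx0 sqr_coord_le.
Qed.

Lemma quadformE n (M : 'M[R]_n) x : quadform M x = dotv x (M *m x).
Proof. by rewrite /quadform /dotv mulmxA. Qed.

Lemma quadformD n (M N : 'M[R]_n) x :
  quadform (M + N) x = quadform M x + quadform N x.
Proof. by rewrite !quadformE mulmxDl dotvDr. Qed.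

Lemma quadformZ n c (M : 'M[R]_n) x : quadform (c *: M) x = c * quadform M x.
Proof. by rewrite !quadformE -scalemxAl dotvZr. Qed.

Lemma quadform1 n (x : 'cV[R]_n) : quadform 1%:M x = dotv x x.
Proof. by rewrite quadformE mul1mx. Qed.

Lemma quadform_gram n m (B : 'M[R]_(m, n)) x :
  quadform (B^T *m B) x = dotv (B *m x) (B *m x).
Proof. by rewrite quadformE -mulmxA dotvC dotv_adjoint. Qed.

Lemma quadform_bounded n (T : 'M[R]_n) :
  exists2 K, 0 < K & forall x, `|quadform T x| <= K * dotv x x.
Proof.
exists (1 + \sum_i \sum_j `|T i j|) => [|x].
  by apply: ltr_pwDl => //; do 2!(apply: sumr_ge0 => ? _).
have coord_le i j : `|x i 0 * x j 0| <= dotv x x.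
  have := sqr_coord_le x i; have := sqr_coord_le x j.
  by rewrite ler_norml; nra.
rewrite mulrDl mul1r; apply: ler_wpDl; first exact: dotvv_ge0.
rewrite quadformE dotvE mulr_suml; apply: (le_trans (ler_norm_sum _ _ _)).
apply: ler_sum => i _; rewrite mxE mulr_sumr mulr_suml.
apply: (le_trans (ler_norm_sum _ _ _)); apply: ler_sum => j _.
by rewrite mulrCA normrM; apply: ler_wpM2l.
Qed.

(** * The smallest generalized eigenvalue minimizes the Rayleigh quotient *)

Lemma singular_colvec n (S : 'M[R]_n) :
  S \notin unitmx -> exists2 v : 'cV[R]_n, v != 0 & S *m v = 0.
Proof.
rewrite -unitmx_tr -row_free_unit -kermx_eq0 => /rowV0Pn[v /sub_kermxP vS v0].
exists v^T; first by rewrite trmx_eq0.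
by apply: (can_inj (@trmxK _ _ _)); rewrite trmx_mul trmxK vS trmx0.
Qed.

(** Expanding the nonnegative value of S at x - e y, where S y = x, gives
    2 e x^T x <= x^T S x + e^2 x^T S^-1 x, and x^T S^-1 x is at most a multiple
    of x^T x, so that a small e makes the last term negligible. *)
Lemma psd_unit_coercive n (S : 'M[R]_n) : S^T = S -> S \in unitmx ->
  (forall x, 0 <= quadform S x) ->
  exists2 c, 0 < c & forall x, dotv x x <= c * quadform S x.
Proof.
move=> Ssym Su Spsd; have [K K0 Kle] := quadform_bounded (invmx S).
exists K => // x; set y := invmx S *m x.
have Sy : S *m y = x by rewrite /y mulKVmx.
have yx : dotv x y <= K * dotv x x.
  by have := Kle x; rewrite quadformE => /(le_trans (ler_norm _)).
have ySx : dotv y (S *m x) = dotv x x by rewrite -{1}Ssym dotvC dotv_adjoint Sy.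
(* The choice e = 1 / K, cleared of denominators. *)
have := Spsd (K *: x - y).
rewrite !quadformE mulmxBr -scalemxAr Sy dotvBr !dotvBl !dotvZr !dotvZl.
rewrite ySx (dotvC y x) => h.
have {h} : 0 <= K * (K * dotv x (S *m x) - dotv x x) by nra.
by rewrite pmulr_rge0 // subr_ge0.
Qed.

Lemma posdef_unit n (N : 'M[R]_n) :
  (forall x, x != 0 -> 0 < quadform N x) -> N \in unitmx.
Proof.
move=> Npos; apply/negPn/negP => /singular_colvec[v v0 Nv].
by have := Npos v v0; rewrite quadformE Nv /dotv mulmx0 mxE ltxx.
Qed.

Section Rayleigh.
Local Open Scope classical_set_scope.
Variables (n : nat) (M N : 'M[R]_n).
Hypotheses (Msym : M^T = M) (Nsym : N^T = N).
Hypothesis Npos : forall x, x != 0 -> 0 < quadform N x.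

Definition rayleigh_values : set R :=
  [set r | exists2 x, x != 0 & quadform M x = r * quadform N x].

Lemma rayleigh_has_lbound : has_lbound rayleigh_values.
Proof.
have Npsd x : 0 <= quadform N x.
  have [->|/Npos/ltW//] := eqVneq x 0.
  by rewrite quadformE mulmx0 /dotv mulmx0 mxE.
have [c c0 cle] := psd_unit_coercive Nsym (posdef_unit Npos) Npsd.
have [K K0 Kle] := quadform_bounded M.
exists (- (K * c)) => r [x x0 Mx]; have N0 := Npos x0.
rewrite -(ler_pM2r N0) -Mx mulNr lerNl -mulrA.
apply: (@le_trans _ _ (K * dotv x x)); last by rewrite ler_pM2l.
by apply: le_trans (Kle x); rewrite -normrN ler_norm.
Qed.

Lemma generalized_eigenvalue_rayleigh :
  generalized_eigenvalue M N `<=` rayleigh_values.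
Proof.
by move=> a [v v0 Mv]; exists v; rewrite // !quadformE Mv dotvZr.
Qed.

(** If M - t N were invertible at the infimum t, coercivity would keep the
    quotient at distance at least 1 / (K c) above t. *)
Lemma rayleigh_inf_eigenvalue : rayleigh_values !=set0 ->
  generalized_eigenvalue M N (inf rayleigh_values).
Proof.
move=> ne; set t := inf _; pose S := M - t *: N.
have qS x : quadform S x = quadform M x - t * quadform N x.
  by rewrite /S -scaleNr quadformD quadformZ mulNr.
have [/singular_colvec[v v0 Sv]|] := boolP (S \notin unitmx).
  exists v => //; apply/eqP.
  by rewrite -subr_eq0 scalemxAl -mulmxBl -/S Sv.
move=> /negPn Su.
have Spsd x : 0 <= quadform S x.
  have [->|x0] := eqVneq x 0.
    by rewrite quadformE mulmx0 /dotv mulmx0 mxE.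
  have N0 := Npos x0; rewrite qS subr_ge0 -ler_pdivlMr //.
  apply: ge_inf; first exact: rayleigh_has_lbound.
  by exists x => //; rewrite divfK // gt_eqF.
have Ssym : S^T = S.
  by rewrite /S linearB linearZ /= Msym Nsym.
have [c c0 cle] := psd_unit_coercive Ssym Su Spsd.
have [K K0 Kle] := quadform_bounded N.
suff : t + (K * c)^-1 <= t by rewrite gerDl invr_le0 leNgt mulr_gt0.
apply: lb_le_inf => // r [x x0 Mx]; have N0 := Npos x0.
rewrite -lerBrDl -(ler_pM2l (mulr_gt0 K0 c0)) divff ?gt_eqF ?mulr_gt0 //.
rewrite -(ler_pM2r N0) mul1r -!mulrA mulrBl -Mx -qS.
apply: (le_trans (ler_norm _)); apply: (le_trans (Kle x)).
by rewrite ler_pM2l.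
Qed.

Lemma lambda_min_gen_le_rayleigh r :
  rayleigh_values r -> lambda_min_gen M N <= r.
Proof.
move=> Er; have lbE := rayleigh_has_lbound.
have [z zlb] := lbE.
apply: (@le_trans _ _ (inf rayleigh_values)); last exact: ge_inf.
apply: ge_inf; last by apply: rayleigh_inf_eigenvalue; exists r.
by exists z => a /generalized_eigenvalue_rayleigh; apply: zlb.
Qed.

End Rayleigh.

(** * Comparing the multipliers *)

Lemma orthonormal_nullbasis_mul0 n m k (A : 'M[R]_(m, n)) (Z : 'M[R]_(n, k)) :
  orthonormal_nullbasis A Z -> A *m Z = 0.
Proof.
move=> [_ /andP[/sub_kermxP ZA _]].
by apply: (can_inj (@trmxK _ _ _)); rewrite trmx_mul ZA trmx0.
Qed.

(** On the range of Z the matrix I + A^T A acts as the identity, and Z is an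
    isometry, so an eigenvector of Z^T Q Z turns into a vector with the same
    quotient for (Q, I + A^T A). *)
Lemma eigenvalue_rayleigh n m k (Q : 'M[R]_n) (A : 'M[R]_(m, n))
    (Z : 'M[R]_(n, k)) a :
  orthonormal_nullbasis A Z -> eigenvalue (Z^T *m Q *m Z) a ->
  rayleigh_values Q (1%:M + A^T *m A) a.
Proof.
move=> ZA /eigenvalueP[v vM v0]; have AZ := orthonormal_nullbasis_mul0 ZA.
have [ZZ _] := ZA.
have xx : dotv (Z *m v^T) (Z *m v^T) = dotv v^T v^T.
  by rewrite -dotv_adjoint mulmxA ZZ mul1mx.
exists (Z *m v^T).
  apply: contraTneq (dotvv_gt0 (x := v^T) _) => [Zv|]; last by rewrite trmx_eq0.
  by rewrite -xx Zv /dotv mulmx0 mxE ltxx.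
rewrite quadformD quadform_gram mulmxA AZ mul0mx quadform1 xx.
rewrite {2}/dotv mulmx0 [X in _ + X]mxE addr0.
by rewrite /quadform /dotv trmx_mul trmxK !mulmxA -!(mulmxA v) mulmxA vM
  -scalemxAl mxE.
Qed.

(** An empty spectrum is treated apart, because the infimum of the empty set is
    0 by convention and [lb_le_inf] does not apply. *)
Lemma multiplier_le n m k (Q : 'M[R]_n) (A : 'M[R]_(m, n)) (Z : 'M[R]_(n, k)) :
  Q^T = Q -> orthonormal_nullbasis A Z ->
  - Num.min 0 (lambda_min (Z^T *m Q *m Z)) <=
  - Num.min 0 (lambda_min_gen Q (1%:M + A^T *m A)).
Proof.
move=> Qsym ZA; rewrite lerN2 le_min ge_min lexx /=.
have [ev0|/set0P ne] :=
    eqVneq [set a | eigenvalue (Z^T *m Q *m Z) a]%classic set0.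
  by rewrite /lambda_min ev0 inf0 ge_min lexx.
rewrite ge_min; apply/orP; right.
apply: lb_le_inf => // a ev; apply: lambda_min_gen_le_rayleigh => //.
- by rewrite linearD /= trmx1 trmx_mul trmxK.
- move=> x x0; rewrite quadformD quadform1 quadform_gram.
  by rewrite ltr_pwDl ?dotvv_gt0 ?dotvv_ge0.
- exact: eigenvalue_rayleigh ev.
Qed.

(** * Comparing the objectives *)

Lemma dotv_box_le0 n (l u x : 'cV[R]_n) :
  (forall i, l i 0 <= x i 0 <= u i 0) -> dotv (x - l) (x - u) <= 0.
Proof.
move=> box; rewrite dotvE; apply: sumr_le0 => i _; rewrite !mxE.
by have /andP[lx xu] := box i; rewrite mulr_ge0_le0 ?subr_ge0 ?subr_le0.
Qed.

Lemma quadobj_perturb_box n (Q : 'M[R]_n) (q l u x : 'cV[R]_n) a :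
  quadobj (Q + a *: 1%:M) (q - a *: (l + u)) (a * dotv l u) x =
  quadform Q x + dotv q x + a * dotv (x - l) (x - u).
Proof.
rewrite /quadobj quadformD quadformZ quadform1 !dotvBl !dotvBr dotvZl dotvDl.
by rewrite (dotvC x u); lra.
Qed.

(** Compared with [quadobj_perturb_box], the objective gains a |A x - b|^2,
    which is 0 here. *)
Lemma quadobj_perturb_box_eq n m (Q : 'M[R]_n) (A : 'M[R]_(m, n)) (b : 'cV[R]_m)
    (q l u x : 'cV[R]_n) a : A *m x = b ->
  quadobj (Q + a *: (1%:M + A^T *m A)) (q - a *: (l + u + 2 *: (A^T *m b)))
    (a * (dotv l u + dotv b b)) x =
  quadform Q x + dotv q x + a * dotv (x - l) (x - u).
Proof.
move=> Ax; rewrite -quadobj_perturb_box /quadobj.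
rewrite !quadformD !quadformZ quadformD quadform_gram Ax.
by rewrite !dotvBl !dotvZl !dotvDl dotvZl dotv_adjoint Ax; lra.
Qed.

End SymmetricForms.

Theorem proposition7 (R : realType) (n m p k : nat)
    (Q : 'M[R]_n) (q : 'cV[R]_n)
    (A : 'M[R]_(m, n)) (b : 'cV[R]_m)
    (C : 'M[R]_(p, n)) (d : 'cV[R]_p)
    (l u : 'cV[R]_n) (Z : 'M[R]_(n, k))
    (Qsym : Q^T = Q)
    (lu : forall i, l i 0 < u i 0)
    (k_gt0 : (0 < k)%N)
    (ZA : orthonormal_nullbasis A Z) :
  let X := feasible A b C d l u in
  let alpha_g := - Num.min 0 (lambda_min_gen Q (1%:M + A^T *m A)) in
  let alpha_z := - Num.min 0 (lambda_min (Z^T *m Q *m Z)) in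
  let mu_GEIG := optimal_value X
    (quadobj (Q + alpha_g *: (1%:M + A^T *m A))
             (q - alpha_g *: (l + u + 2 *: (A^T *m b)))
             (alpha_g * (dotv l u + dotv b b))) in
  let mu_EIGZ := optimal_value X
    (quadobj (Q + alpha_z *: 1%:M)
             (q - alpha_z *: (l + u))
             (alpha_z * dotv l u)) in
  (mu_EIGZ >= mu_GEIG)%E.
Proof.
have := multiplier_le Qsym ZA; cbv zeta.
move: (- Num.min 0 _) (- Num.min 0 _) => alpha_z alpha_g alpha_le.
apply: le_ereal_inf_tmp => _ [x Xx <-]; have [Ax _ box] := Xx.
apply: ge_ereal_inf; eexists; first by exists x.
rewrite lee_fin quadobj_perturb_box quadobj_perturb_box_eq // lerD2l.
by rewrite ler_wnM2r // dotv_box_le0.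
Qed.
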